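(* Let $n\ge 1$, let $N'\subseteq\{1,\dots,n\}$, and for each $i\in N'$ let $\underline{x}_i,\overline{x}_i$ be real numbers with $0<\underline{x}_i<\overline{x}_i$. For $i\in N'$ define $$S^x_i=\{(\tilde{x}_i,x_i)\in\mathbb{R}^2:\ x_i\le e^{\tilde{x}_i},\ \log\underline{x}_i\le\tilde{x}_i\le\log\overline{x}_i,\ \underline{x}_i\le x_i\le\overline{x}_i\}.$$ Then for each $i\in N'$ the inequality $$x_i\le\frac{\overline{x}_i-\underline{x}_i}{\log\overline{x}_i-\log\underline{x}_i}\,(\tilde{x}_i-\log\underline{x}_i)+\underline{x}_i$$ is valid for $S^x_i$.
   Context: An inequality is valid for a set if every point of the set satisfies it. $\log$ denotes the natural logarithm. *)

(* Defs.v *)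
From HB Require Import structures.
From mathcomp Require Import all_boot all_order all_algebra.
From mathcomp Require Import all_classical all_reals all_analysis.

Set Implicit Arguments.
Unset Strict Implicit.
Unset Printing Implicit Defensive.

Import Order.TTheory GRing.Theory Num.Theory.

Local Open Scope classical_set_scope.
Local Open Scope ring_scope.

Definition valid_le (R : realType) (T : Type) (S : set T) (f g : T -> R) : Prop :=
  forall p : T, S p -> f p <= g p.

(* A point p of the plane is the pair (xt_i, x_i): p.1 is the log-space variable
   (written with a tilde in the usual notation) and p.2 the original one.
   [xl i] and [xu i] are the lower and upper bounds on x_i. *)
Definition Sx (R : realType) (n : nat) (xl xu : 'I_n -> R) (i : 'I_n) :
    set (R * R) :=
  [set p | [/\ p.2 <= expR p.1,
               ln (xl i) <= p.1 <= ln (xu i) &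
               xl i <= p.2 <= xu i]].

(* Main.v *)
Require Import Defs.
From mathcomp Require Import all_boot all_order all_algebra.
From mathcomp Require Import all_classical all_reals all_analysis.
From mathcomp Require Import ring.
Import Order.TTheory GRing.Theory Num.Theory.
Local Open Scope ring_scope.

(** The right-hand side of the inequality is the secant line of the exponential
    through the points of abscissae [ln (xl i)] and [ln (xu i)], where the
    exponential takes the values [xl i] and [xu i].  A convex function lies below
    its secant between the two points ([expR_le_secant]), so that on the box
    [p.2 <= expR p.1] is at most the value of the secant at [p.1]. *)

(** Convexity of the exponential, read on the weight [(x - a) / (b - a)] which
    exhibits [x] as a convex combination of [b] and [a]. *)
Lemma expR_le_secant {R : realType} [a b x : R] : a < b -> a <= x <= b ->
  expR x <= (expR b - expR a) / (b - a) * (x - a) + expR a.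
Proof.
move=> ab /andP[ax xb].
have ba0 : 0 < b - a by rewrite subr_gt0.
have ba_neq0 : b - a != 0 by rewrite gt_eqF.
pose t := (x - a) / (b - a).
have t0 : 0 <= t by rewrite divr_ge0 ?subr_ge0 // ltW.
have t1 : t <= 1 by rewrite ler_pdivrMr // mul1r lerD2r.
have := convex_expR (Itv01 t0 t1) b a.
rewrite !convRE /= /unstable.onem.
have -> : t * b + (1 - t) * a = x by rewrite /t; field.
suff -> : t * expR b + (1 - t) * expR a =
          (expR b - expR a) / (b - a) * (x - a) + expR a by [].
by rewrite /t; field.
Qed.

Theorem proposition1 (R : realType) (n : nat) (hn : (1 <= n)%N)
    (N' : {set 'I_n}) (xl xu : 'I_n -> R)
    (hx : forall i : 'I_n, i \in N' -> 0 < xl i < xu i) :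
  forall i : 'I_n, i \in N' ->
    valid_le (Sx xl xu i)
      (fun p => p.2)
      (fun p => (xu i - xl i) / (ln (xu i) - ln (xl i)) * (p.1 - ln (xl i))
                + xl i).
Proof.
move=> i /hx /andP[xl_gt0 xl_lt_xu] p [p_le_exp p_itv _].
have xu_gt0 : 0 < xu i := lt_trans xl_gt0 xl_lt_xu.
have ln_lt : ln (xl i) < ln (xu i) by rewrite ltr_ln.
by have := le_trans p_le_exp (expR_le_secant ln_lt p_itv); rewrite !lnK.
Qed.
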